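(* (Mayer-Vietoris exact sequence.) Let $(X,\overline p)$ be a paracompact perverse space, endowed with an open cover $(U_1,U_2)$ and a subordinated partition of unity $(f_1,f_2)$. For $i=1,2$, denote by $\mathcal U_i$ the cover of $U_i$ consisting of the open subsets $U_1\cap U_2$ and $f_i^{-1}(]1/2,1])$, and by $\mathcal U$ the cover of $X$ that is the union of the covers $\mathcal U_1$ and $\mathcal U_2$. Then the canonical inclusions $U_i\subset X$ and $U_1\cap U_2\subset U_i$ induce a short exact sequence $$0\to\widetilde N^{*,\mathcal U}_{\overline p}(X;R)\xrightarrow{\ \iota\ }\widetilde N^{*,\mathcal U_1}_{\overline p}(U_1;R)\oplus\widetilde N^{*,\mathcal U_2}_{\overline p}(U_2;R)\xrightarrow{\ \varphi\ }\widetilde N^{*}_{\overline p}(U_1\cap U_2;R)\to0,$$ where $\varphi(\omega_1,\omega_2)=\omega_1-\omega_2$ (the restrictions to $U_1\cap U_2$ being understood).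
   Context: $R$ is a commutative ring with unity. Filtered spaces. A filtered space is a Hausdorff space $X$ with a filtration by closed subspaces $\emptyset=X_{-1}\subseteq X_0\subseteq\dots\subseteq X_{n-1}\subsetneq X_n=X$; $n=\dim X$ is the formal dimension. Strata are the non-empty connected components of the $X_i\setminus X_{i-1}$; a stratum $S\subset X_i\setminus X_{i-1}$ has $\operatorname{codim}S=n-i$; it is regular if $\operatorname{codim}S=0$, singular otherwise. A perversity on $X$ is a map $\overline p$ from the set of strata to $\mathbb Z\cup\{\pm\infty\}$ with value $0$ on regular strata; $(X,\overline p)$ is a perverse space. An open subset $U\subset X$ has the induced filtration $U_i=U\cap X_i$ and the induced perversity, still denoted $\overline p$ (value on a stratum of $U$ = value of $\overline p$ on the stratum of $X$ containing it). Filtered simplices. A filtered singular simplex is a continuous map $\sigma\colon\Delta\to X$ from a euclidean simplex (with ordered vertices) with a join decomposition $\Delta=\Delta_0*\dots*\Delta_n$ (some $\Delta_i$ may be empty), compatible with the vertex order, such that $\sigma^{-1}(X_i)=\Delta_0*\dots*\Delta_i$ for all $i$. It is regular if $\Delta_n\neq\emptyset$. A regular face operator is the inclusion $\delta_\ell\colon\nabla\to\Delta$ of a codimension-one face with $\nabla_i=\nabla\cap\Delta_i$ and $\nabla_n\ne\emptyset$. Blow-up. For an ordered simplicial complex $K$, $N_*(K)$ is its simplicial chain complex over $R$, $N^*(K)=\operatorname{Hom}(N_*(K),R)$ with $(\delta f)(v)=-(-1)^{|f|}f(\partial v)$, and $\mathbf 1_F$ is the cochain equal to $1$ on the simplex $F$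 and $0$ on the others. For a simplex $E$, $\mathtt cE=E*[\mathtt v]$ is the cone with apex $\mathtt v$ as last vertex ($\mathtt c\emptyset=[\mathtt v]$); its faces are written $(F,0)=F$ ($\emptyset\ne F$ a face of $E$) and $(F,1)=F*[\mathtt v]$ ($F$ a possibly empty face of $E$). Put $|(F,\varepsilon)|=\dim F+\varepsilon$, with $|(\emptyset,1)|=0$. For a regular simplex $\Delta$ put $\widetilde N^*(\Delta)=N^*(\mathtt c\Delta_0)\otimes\dots\otimes N^*(\mathtt c\Delta_{n-1})\otimes N^*(\Delta_n)$ with the tensor product differential and basis $\mathbf 1_{(F,\varepsilon)}=\mathbf 1_{(F_0,\varepsilon_0)}\otimes\dots\otimes\mathbf 1_{(F_{n-1},\varepsilon_{n-1})}\otimes\mathbf 1_{F_n}$ ($\varepsilon_n=0$, $F_n\neq\emptyset$). For $\ell\in\{1,\dots,n\}$, $\|\mathbf 1_{(F,\varepsilon)}\|_\ell=-\infty$ if $\varepsilon_{n-\ell}=1$ and $=\sum_{i>n-\ell}|(F_i,\varepsilon_i)|$ if $\varepsilon_{n-\ell}=0$; for a linear combination with non-zero coefficients take the maximum; $\|0\|_\ell=-\infty$. $\widetilde N^*(X;R)$ is the complex of families $\omega=(\omega_\sigma)_\sigma$ indexed by regular simplices $\sigma\colon\Delta\to X$, $\omega_\sigma\in\widetilde N^*(\Delta)$, with $\delta_\ell^*\omega_\sigma=\omega_{\sigma\circ\delta_\ell}$ for every regular face operator; $(\delta\omega)_\sigma=\delta(\omega_\sigma)$. For a singular stratum $S$,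 $\|\omega\|_S=\sup\{\|\omega_\sigma\|_{\operatorname{codim}S}: \sigma\text{ regular},\ \operatorname{im}\sigma\cap S\neq\emptyset\}$. $\omega$ is $\overline p$-allowable if $\|\omega\|_S\le\overline p(S)$ for all singular $S$. $\widetilde N^*_{\overline p}(X;R)$ is the complex of $\omega$ with $\omega,\delta\omega$ both $\overline p$-allowable. Small cochains. For an open cover $\mathcal V$ of $X$, a $\mathcal V$-small simplex is a regular simplex $\sigma\colon\Delta\to X$ with $\operatorname{im}\sigma\subset V$ for some $V\in\mathcal V$. $\widetilde N^{*,\mathcal V}(X;R)$ is defined like $\widetilde N^*(X;R)$ but with families $(\omega_\sigma)$ indexed only by $\mathcal V$-small simplices (compatible with regular face operators), and $\widetilde N^{*,\mathcal V}_{\overline p}(X;R)$ is the subcomplex of those $\omega$ such that $\omega$ and $\delta\omega$ are $\overline p$-allowable (with $\|\cdot\|_S$ computed over $\mathcal V$-small simplices). The inclusions of open subsets induce restriction maps between these complexes; $\iota$ is given by the two restrictions to $U_1$ and $U_2$. *)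

(* Defs.v *)
From HB Require Import structures.
From mathcomp Require Import all_boot all_order all_algebra zify.
From mathcomp Require Import all_classical all_reals all_analysis.
Set Implicit Arguments.
Unset Strict Implicit.
Unset Printing Implicit Defensive.
Import Order.TTheory GRing.Theory Num.Theory.
Import numFieldNormedType.Exports.
Local Open Scope ring_scope.

Lemma antisym_sum0 (R : pzRingType) (I : finType) (a : I -> I -> R) :
  (forall x y, x != y -> a x y = - a y x) ->
  \sum_x \sum_(y | y != x) a x y = 0.
Proof.
move=> aN; pose r (x y : I) := (enum_rank x < enum_rank y)%N.
have rN x y : y != x -> ~~ r x y = r y x.
  by rewrite eq_sym => xy; rewrite /r -leqNgt leq_eqVlt val_eqE
    (inj_eq enum_rank_inj) eq_sym (negbTE xy).
rewrite (eq_bigr (fun x => \sum_(y | r x y) a x y + \sum_(y | r y x) a x y));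
  last first.
  move=> x _; rewrite (bigID (r x)) /=; congr (_ + _); apply: eq_bigl => y.
    by apply: andb_idl; apply: contraTneq => ->; rewrite /r ltnn.
  have [->|yx] := eqVneq y x; first by rewrite /r ltnn.
  by rewrite /= rN.
rewrite big_split /= [X in _ + X](exchange_big_dep xpredT) //= -big_split /=.
apply: big1 => x _; rewrite -big_split /=; apply: big1 => y xy.
rewrite aN ?addNr//; apply: contraTneq xy => ->; by rewrite /r ltnn.
Qed.

Section OrderedSimplices.
Variables (R : comPzRingType) (V : finType) (lt : rel V).
Implicit Types (A B C F G : {set V}) (f : {set V} -> R).

Definition sdim F : nat := #|F|.-1.

Definition vrank F (v : V) : nat := #|[set w in F | lt w v]|.

(* f(∂G), where ∂G is the alternating sum of the faces G \ v over the vertices v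
   of G listed in the order lt; a vertex has no face (no augmentation). *)
Definition eval_bd f G : R :=
  \sum_(v in G | G :\ v != finset.set0) (-1) ^+ vrank G v * f (G :\ v).

(* The differential on N^k: (δf)(G) = -(-1)^k f(∂G). *)
Definition cobd (k : nat) f G : R := - (-1) ^+ k * eval_bd f G.

(* The cochain 1_F. *)
Definition ind F : {set V} -> R := fun G => (G == F)%:R.

Definition inc A C : R := cobd (sdim A) (ind A) C.

Lemma eval_bd_ind0 A C :
  ~~ [&& A != finset.set0, A \subset C & #|C| == #|A|.+1] ->
  eval_bd (ind A) C = 0.
Proof.
move=> h; apply: big1 => v /andP[vC nz]; rewrite /ind.
case: eqP => [E|]; last by rewrite mulr0.
by move: h; rewrite (cardsD1 v C) vC -E nz finset.subD1set eqxx.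
Qed.

Lemma inc_neq0 A C : inc A C != 0 ->
  [/\ A != finset.set0, A \subset C & #|C| = #|A|.+1].
Proof.
move=> h; have : [&& A != finset.set0, A \subset C & #|C| == #|A|.+1].
  apply: contraNT h => h; by rewrite /inc /cobd eval_bd_ind0 ?mulr0.
by case/and3P => ? ? /eqP.
Qed.

Lemma inc_sdim A C : inc A C != 0 -> sdim C = (sdim A).+1.
Proof.
case/inc_neq0=> A0 _ E; rewrite /sdim E prednK // lt0n.
by apply: contra A0; rewrite cards_eq0.
Qed.

Hypothesis lt_irr : irreflexive lt.
Hypothesis lt_trans : transitive lt.
Hypothesis lt_total : forall v w, v != w -> lt v w || lt w v.

Lemma vrank_swap C v w : v \in C -> w \in C -> lt v w ->
  (vrank (C :\ v) w).+1 = vrank C w /\ vrank (C :\ w) v = vrank C v.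
Proof.
move=> vC wC vw; split.
  rewrite /vrank [in RHS](cardsD1 v) inE vC vw add1n; congr _.+1.
  by apply: eq_card => x; rewrite !inE andbA.
apply: eq_card => x; rewrite !inE; have [->|//] := eqVneq x w.
rewrite wC /=; apply/esym/negbTE/negP => wv.
by move: (lt_trans vw wv); rewrite lt_irr.
Qed.

Lemma eval_bd_bd A C : eval_bd (eval_bd (ind A)) C = 0.
Proof.
pose a v w : R := if [&& v \in C, w \in C & C :\ v :\ w != finset.set0] then
  (-1) ^+ vrank C v * ((-1) ^+ vrank (C :\ v) w * ind A (C :\ v :\ w)) else 0.
transitivity (\sum_v \sum_(w | w != v) a v w); last first.
  apply: antisym_sum0 => v w vw; rewrite /a.
  rewrite (_ : C :\ w :\ v = C :\ v :\ w); last first.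
    by apply/setP => x; rewrite !inE andbCA.
  have [vC|//] := boolP (v \in C); last by rewrite andbF oppr0.
  have [wC|//] := boolP (w \in C); last by rewrite /= oppr0.
  case: ifP => _; last by rewrite /= oppr0.
  have [/orP[h|h]] := lt_total vw.
    have [<- ->] := vrank_swap vC wC h.
    by rewrite exprS !mulN1r !mulNr opprK mulrCA.
  have [<- ->] := vrank_swap wC vC h.
  by rewrite exprS !mulN1r !mulNr mulrCA.
rewrite /eval_bd big_mkcond; apply: eq_bigr => v _.
have [vC|vC] := boolP (v \in C); last first.
  by rewrite /= big1 // => w _; rewrite /a (negbTE vC).
case: ifP => /= nz; last first.
  rewrite big1 // => w _; rewrite /a; case: ifP => // /and3P[_ _].
  by move/negbT: nz; rewrite negbK => /eqP ->; rewrite finset.set0D eqxx.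
rewrite mulr_sumr [RHS]big_mkcond [LHS]big_mkcond; apply: eq_bigr => w _.
rewrite /a vC !inE /=; have [->|_] //= := eqVneq w v.
Qed.

Lemma inc_inc A C : \sum_B inc A B * inc B C = 0.
Proof.
pose s : R := (-1) ^+ sdim A * (-1) ^+ (sdim A).+1.
transitivity (s * \sum_B eval_bd (ind B) C * eval_bd (ind A) B).
  rewrite mulr_sumr; apply: eq_bigr => B _; rewrite [LHS]mulrC.
  have [h|] := eqVneq (inc A B) 0.
    by rewrite h -(@signrMK _ (sdim A) (eval_bd (ind A) B)) -[_ * eval_bd _ _]opprK
      -mulNr -/(cobd _ _ _) -/(inc A B) h oppr0 !mulr0.
  move=> /inc_sdim h; rewrite {1}/inc /cobd h /inc /cobd /s.
  by rewrite !mulNr mulrN opprK mulrACA [X in X * _]mulrC.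
rewrite [X in _ * X](_ : _ = 0) ?mulr0 // -[RHS](eval_bd_bd A C).
rewrite /eval_bd; under eq_bigr do rewrite mulr_suml.
rewrite exchange_big /=; apply: eq_bigr => v _.
rewrite (bigD1 (C :\ v)) //= [X in _ + X]big1 ?addr0; last first.
  by move=> B /negbTE nB; rewrite {1}/ind eq_sym nB mulr0 mul0r.
by rewrite {1}/ind eqxx mulr1.
Qed.

End OrderedSimplices.

Section TensorCochains.
Variables (R : comPzRingType) (V : finType) (lt : rel V) (N : nat).
Local Notation multi := {ffun 'I_N -> {set V}}.
Implicit Types E F G H : multi.

(* The complexes N^*(K_i) are free with finite bases 1_F, so an element of
   N^*(K_0) ⊗ ... ⊗ N^*(K_(N-1)) is given by its coefficients on the products
   1_E = 1_(E_0) ⊗ ... ⊗ 1_(E_(N-1)).  tensor a is the coefficient function of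
   a_0 ⊗ ... ⊗ a_(N-1). *)
Definition tensor (a : 'I_N -> {set V} -> R) E : R := \prod_i a i (E i).

Definition tdegree E : nat := \sum_i sdim (E i).

(* The coefficient on 1_G of the tensor product differential
   δ 1_F = \sum_i (-1)^(|F_0| + ... + |F_(i-1)|)
             1_(F_0) ⊗ ... ⊗ δ 1_(F_i) ⊗ ... ⊗ 1_(F_(N-1)). *)
Definition tcobd F G : R :=
  \sum_(i < N) (-1) ^+ (\sum_(j < N | (j < i)%N) sdim (F j)) *
    tensor (fun j => if j == i then cobd lt (sdim (F j)) (ind R (F j))
                     else ind R (F j)) G.

Let M (i j : 'I_N) A B : R := if j == i then inc R lt A B else ind R A B.
Let P i F G : R := \prod_j M i j (F j) (G j).
Let s (i : 'I_N) F : nat := \sum_(j < N | (j < i)%N) sdim (F j).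

Lemma tcobdE F G : tcobd F G = \sum_i (-1) ^+ s i F * P i F G.
Proof.
apply: eq_bigr => i _; congr (_ * _); apply: eq_bigr => j _.
by rewrite /M; case: eqP.
Qed.

Lemma ind_neq0 (A B : {set V}) : ind R A B != 0 -> B = A.
Proof. by rewrite /ind; case: (B =P A) => //; rewrite eqxx. Qed.

Lemma M_neq0 i j A B : M i j A B != 0 ->
  A \subset B /\ sdim B = (sdim A + (j == i))%N.
Proof.
rewrite /M; case: (j == i) => [h|/ind_neq0->]; last by rewrite addn0.
by rewrite addn1 (inc_sdim h); case/inc_neq0: h.
Qed.

Lemma P_neq0 i F G : P i F G != 0 -> forall j, M i j (F j) (G j) != 0.
Proof.
move=> h j; apply: contra_neq h => h; by rewrite /P (bigD1 j) //= h mul0r.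
Qed.

Lemma tcobd_P F G : tcobd F G != 0 -> exists i, P i F G != 0.
Proof.
rewrite tcobdE => h; have [/existsP[i Pi]|] := boolP [exists i, P i F G != 0].
  by exists i.
rewrite negb_exists => /forallP h'; case/eqP: h; apply: big1 => i _.
by have := h' i; rewrite negbK => /eqP->; rewrite mulr0.
Qed.

Lemma tcobd_degree F G : tcobd F G != 0 -> tdegree G = (tdegree F).+1.
Proof.
case/tcobd_P => i /P_neq0 h.
rewrite /tdegree (eq_bigr (fun j => sdim (F j) + (j == i))%N); last first.
  by move=> j _; case: (M_neq0 (h j)).
rewrite big_split /= -addn1; congr (_ + _)%N.
by rewrite (bigD1 i) //= eqxx big1 // => j /negbTE ->.
Qed.

Lemma tcobd_sub F G : tcobd F G != 0 -> forall j, F j \subset G j.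
Proof. by case/tcobd_P => i /P_neq0 h j; case: (M_neq0 (h j)). Qed.

Lemma tcobd_nonempty F G : tcobd F G != 0 ->
  forall j, G j != finset.set0 -> F j != finset.set0.
Proof.
case/tcobd_P => i /P_neq0 h j Gj; move: (h j); rewrite /M.
by case: (j == i) => [/inc_neq0[]//|/ind_neq0 <-].
Qed.

Let Q (i i' : 'I_N) F H : R :=
  \prod_j \sum_B M i j (F j) B * M i' j B (H j).

Lemma sum_M_ind (g : {set V} -> R) A : \sum_B ind R A B * g B = g A.
Proof.
rewrite (bigD1 A) //= /ind eqxx mul1r big1 ?addr0 // => B /negbTE ->.
by rewrite mul0r.
Qed.

Lemma sum_ind_M (g : {set V} -> R) A : \sum_B g B * ind R B A = g A.
Proof.
rewrite (bigD1 A) //= /ind eqxx mulr1 big1 ?addr0 // => B.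
by rewrite eq_sym => /negbTE ->; rewrite mulr0.
Qed.

Hypothesis lt_irr : irreflexive lt.
Hypothesis lt_trans : transitive lt.
Hypothesis lt_total : forall v w, v != w -> lt v w || lt w v.

Lemma tcobd_tcobd F H : \sum_G tcobd F G * tcobd G H = 0.
Proof.
have QE i i' : \sum_G P i F G * P i' G H = Q i i' F H.
  rewrite /Q bigA_distr_bigA /=; apply: eq_bigr => G _.
  by rewrite /P -big_split.
have Qii i : Q i i F H = 0.
  rewrite /Q (bigD1 i) //= (eq_bigr (fun B => inc R lt (F i) B * inc R lt B (H i))).
    by rewrite inc_inc // mul0r.
  by move=> B _; rewrite /M eqxx.
have QC i i' : Q i i' F H = Q i' i F H.
  apply: eq_bigr => j _; rewrite /M; case: eqP => [->|ji].
    have [//|_] := eqVneq i i'.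
    by rewrite sum_M_ind (sum_ind_M (inc R lt (F i))).
  have [ji'|//] := eqVneq j i'.
  by rewrite sum_M_ind (sum_ind_M (inc R lt (F j))).
have sE i i' G : (-1) ^+ s i' G * P i F G =
    (-1) ^+ (s i' F + (i < i')%N) * P i F G :> R.
  have [->|/P_neq0 h] := eqVneq (P i F G) 0; first by rewrite !mulr0.
  congr ((-1) ^+ _ * _); rewrite /s.
  rewrite (eq_bigr (fun j => sdim (F j) + (j == i))%N); last first.
    by move=> j _; case: (M_neq0 (h j)).
  rewrite big_split /=; congr (_ + _)%N.
  have [ii'|ii'] := boolP (i < i')%N.
    by rewrite (bigD1 i) //= eqxx big1 // => j /andP[_ /negbTE ->].
  by rewrite big1 // => j ji'; case: eqP ii' => // <-; rewrite ji'.
pose a i i' : R := (-1) ^+ s i F * ((-1) ^+ (s i' F + (i < i')%N) * Q i i' F H).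
transitivity (\sum_(i < N) \sum_(i' < N) a i i').
  under eq_bigr do rewrite !tcobdE mulr_suml.
  rewrite exchange_big /=; apply: eq_bigr => i _.
  under eq_bigr do rewrite mulr_sumr.
  rewrite exchange_big /=; apply: eq_bigr => i' _.
  rewrite /a -QE !mulr_sumr; apply: eq_bigr => G _.
  by rewrite -!mulrA; congr (_ * _); rewrite mulrA [_ * (-1) ^+ _]mulrC sE mulrA.
rewrite (eq_bigr (fun i => \sum_(i' | i' != i) a i i')); last first.
  by move=> i _; rewrite (bigD1 i) //= /a Qii !mulr0 add0r.
apply: antisym_sum0 => i i' ii'; rewrite /a QC !exprD.
have : (i < i')%N != (i' < i)%N.
  by move: ii'; rewrite -val_eqE /=; case: ltngtP.
case: ltngtP => //= _ _; rewrite expr1 expr0 mulr1 ?mulrN1 ?mulNr ?mulrN ?opprK.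
  by rewrite mulrCA.
by rewrite mulrCA.
Qed.

End TensorCochains.

Section Naturality.
Variables (R : comPzRingType) (V V' : finType) (lt : rel V) (lt' : rel V').
Variables (g : V -> V') (N : nat).
Hypothesis g_inj : injective g.
Hypothesis g_lt : forall x y, lt' (g x) (g y) = lt x y.

Definition multi_img (E : {ffun 'I_N -> {set V}}) : {ffun 'I_N -> {set V'}} :=
  [ffun i => g @: E i].

Lemma multi_img_inj : injective multi_img.
Proof.
move=> E F /ffunP EF; apply/ffunP => i.
by have := EF i; rewrite !ffunE => /(imset_inj g_inj).
Qed.

Lemma sdim_imset (A : {set V}) : sdim (g @: A) = sdim A.
Proof. by rewrite /sdim card_imset. Qed.

Lemma imset_setD1 (A : {set V}) x : (g @: A) :\ g x = g @: (A :\ x).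
Proof.
apply/setP => y; rewrite !inE; apply/andP/imsetP.
  case=> yx /imsetP[z zA E]; exists z; rewrite // !inE zA andbT.
  by apply: contra yx => /eqP <-; rewrite E.
by case=> z /[!inE]/andP[zx zA] ->; rewrite (inj_eq g_inj) imset_f.
Qed.

Lemma inc_imset (A C : {set V}) : inc R lt' (g @: A) (g @: C) = inc R lt A C.
Proof.
rewrite /inc /cobd sdim_imset; congr (_ * _); rewrite /eval_bd.
rewrite big_imset_cond /=; last exact: in2W; apply: eq_big => [x|x _].
  by rewrite imset_setD1 imset_eq0.
congr (_ ^+ _ * _); last by rewrite imset_setD1 /ind (inj_eq (imset_inj g_inj)).
rewrite /vrank -(card_imset _ g_inj); apply: eq_card => y; rewrite inE.
apply/andP/imsetP => [[/imsetP[z zC ->]]|[z]].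
  by rewrite g_lt => zx; exists z => //; rewrite inE zC.
by rewrite inE => /andP[zC zx] ->; rewrite g_lt imset_f.
Qed.

Lemma tcobd_img (F G : {ffun 'I_N -> {set V}}) :
  tcobd R lt' (multi_img F) (multi_img G) = tcobd R lt F G.
Proof.
rewrite !tcobdE; apply: eq_bigr => i _; congr ((-1) ^+ _ * _).
  by apply: eq_bigr => j _; rewrite ffunE sdim_imset.
apply: eq_bigr => j _; rewrite !ffunE; case: eqP => _; first exact: inc_imset.
by rewrite /ind (inj_eq (imset_inj g_inj)).
Qed.

Lemma tdegree_img E : tdegree (multi_img E) = tdegree E.
Proof. by apply: eq_bigr => i _; rewrite ffunE sdim_imset. Qed.

End Naturality.

(* Vertices of a cone: None is the apex, and it comes last. *)
Definition clt p (x y : option 'I_p) : bool :=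
  match x, y with
  | Some i, Some j => (i < j)%N
  | Some _, None => true
  | None, _ => false
  end.

Lemma clt_irr p : irreflexive (@clt p).
Proof. by case=> //= i; rewrite ltnn. Qed.

Lemma clt_trans p : transitive (@clt p).
Proof. by move=> [j|] [i|] [k|] //=; exact: ltn_trans. Qed.

Lemma clt_total p (v w : option 'I_p) : v != w -> clt v w || clt w v.
Proof.
case: v w => [i|] [j|] //= ij; rewrite -neq_ltn.
by apply: contra ij => /eqP/val_inj ->.
Qed.

(* A simplex Δ with m+1 ordered vertices and a decomposition
   Δ = Δ_0 * ... * Δ_n into (possibly empty) joinands is given by the
   nondecreasing map b sending each vertex to the index of its joinand. *)
Section BlowupSimplex.
Variables (R : comPzRingType) (n m : nat).
Variable b : {ffun 'I_m.+1 -> 'I_n.+1}.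

(* Vertices of the cone cΔ_i for i < n, and of Δ_n for i = n.  A nonempty
   subset E_i encodes (F_i, ε_i): F_i is its set of vertices other than the apex
   and ε_i = 1 iff the apex belongs to it, so |(F_i, ε_i)| = sdim E_i, including
   |(∅, 1)| = 0. *)
Definition cone_vertices (i : 'I_n.+1) : {set option 'I_m.+1} :=
  [set x | if x is Some v then b v == i else i != ord_max].

(* The basis elements 1_(F,ε) of degree k of the blow-up of Δ. *)
Definition is_cell (k : nat) (E : {ffun 'I_n.+1 -> {set option 'I_m.+1}}) :=
  [forall i, (E i != finset.set0) && (E i \subset cone_vertices i)]
  && (tdegree E == k).

Definition cell (k : nat) : Type := {E | is_cell k E}.
HB.instance Definition _ k := Finite.on (cell k).
HB.instance Definition _ k := SubFinite.on (cell k).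

Definition bcochain (k : nat) : Type := {ffun cell k -> R^o}.
HB.instance Definition _ k := GRing.Lmodule.on (bcochain k).

Definition bcobd k (w : bcochain k) : bcochain k.+1 :=
  [ffun G => \sum_(F : cell k) w F * tcobd R (@clt _) (val F) (val G)].

Lemma bcobd_is_linear k : linear (@bcobd k).
Proof.
move=> a w w'; apply/ffunP => G; rewrite !ffunE scaler_sumr -big_split.
apply: eq_bigr => F _; rewrite !ffunE mulrDl; congr (_ + _).
exact: (esym (mulrA a _ _)).
Qed.

Lemma bcobd_bcobd k (w : bcochain k) : bcobd (bcobd w) = 0.
Proof.
apply/ffunP => H; rewrite !ffunE.
under eq_bigr do rewrite ffunE mulr_suml.
rewrite exchange_big /= big1 // => F _.
under eq_bigr do rewrite -mulrA.
rewrite -mulr_sumr (_ : (\sum__ _) = 0) ?mulr0 //.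
rewrite -[RHS](tcobd_tcobd R (@clt_irr _) (@clt_trans _) (@clt_total _)
  (val F) (val H)).
rewrite [RHS](bigID (is_cell k.+1)) /= [X in _ = _ + X]big1 ?addr0; last first.
  move=> G; apply: contraNeq => nz.
  have FG : tcobd R (@clt m.+1) (val F) G != 0.
    by apply: contra_neq nz => ->; rewrite mul0r.
  have GH : tcobd R (@clt m.+1) G (val H) != 0.
    by apply: contra_neq nz => ->; rewrite mulr0.
  have /andP[/forallP Hc _] := valP H; have /andP[_ /eqP Fd] := valP F.
  rewrite /is_cell (tcobd_degree FG) Fd eqxx andbT.
  apply/forallP => i; have /andP[H0 HV] := Hc i.
  by rewrite (tcobd_nonempty GH) // (fintype.subset_trans _ HV) // (tcobd_sub GH).
by rewrite [RHS](big_sub (is_cell k.+1)).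
Qed.
End BlowupSimplex.

(* The face of Δ opposite to its vertex l, with the induced decomposition. *)
Section RegularFaces.
Variables (R : comPzRingType) (n m : nat).
Variables (b : {ffun 'I_m.+2 -> 'I_n.+1}) (l : 'I_m.+2).

Definition face_blocks : {ffun 'I_m.+1 -> 'I_n.+1} := [ffun v => b (lift l v)].

Let g : option 'I_m.+1 -> option 'I_m.+2 := omap (lift l).

Let g_inj : injective g.
Proof. apply: inj_omap; exact: lift_inj. Qed.

Let g_lt x y : clt (g x) (g y) = clt x y.
Proof.
case: x y => [v|] [w|] //=.
by rewrite /bump; case: leqP; case: leqP; lia.
Qed.

Lemma face_cell_subproof k (E : cell face_blocks k) :
  is_cell b k (multi_img g (val E)).
Proof.
have /andP[/forallP E0 /eqP Ed] := valP E.
rewrite /is_cell tdegree_img // Ed eqxx andbT; apply/forallP => i.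
have /andP[Ei EV] := E0 i; rewrite ffunE imset_eq0 Ei /=.
apply/fintype.subsetP => x /imsetP[y /(fintype.subsetP EV) + ->].
by rewrite !inE; case: y => //= v; rewrite ffunE.
Qed.

Definition face_cell k (E : cell face_blocks k) : cell b k :=
  Sub (multi_img g (val E)) (face_cell_subproof E).

Definition face_pull k (w : bcochain R b k) : bcochain R face_blocks k :=
  [ffun E => w (face_cell E)].

Lemma face_pull_is_linear k : linear (@face_pull k).
Proof. by move=> a w w'; apply/ffunP => E; rewrite !ffunE. Qed.

Lemma face_cell_inj k : injective (@face_cell k).
Proof. by move=> E F [] /(multi_img_inj g_inj) /val_inj. Qed.

Lemma face_pull_bcobd k (w : bcochain R b k) :
  face_pull (bcobd w) = bcobd (face_pull w).
Proof.
apply/ffunP => G; rewrite !ffunE.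
pose I := [set face_cell E | E : cell face_blocks k]%SET.
rewrite (bigID (mem I)) /= [X in _ + X]big1 ?addr0; last first.
  move=> F; apply: contraNeq => nz.
  have {nz}FG : tcobd R (@clt m.+2) (val F) (multi_img g (val G)) != 0.
    by apply: contra_neq nz => ->; rewrite mulr0.
  pose E := [ffun i => g @^-1: (val F i)] : {ffun 'I_n.+1 -> {set option 'I_m.+1}}.
  have FE : val F = multi_img g E.
    apply/ffunP => i; rewrite !ffunE; apply/setP => x; apply/idP/imsetP.
      move=> xF; have := fintype.subsetP (tcobd_sub FG i) _ xF; rewrite ffunE.
      by case/imsetP => y _ E0; exists y => //; rewrite inE -E0.
    by case=> y /[!inE] + ->.
  have /andP[/forallP F0 /eqP Fd] := valP F.
  have Ecell : is_cell face_blocks k E.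
    rewrite /is_cell -(tdegree_img g_inj) -FE Fd eqxx andbT.
    apply/forallP => i; have /andP[] := F0 i; rewrite FE ffunE imset_eq0 => -> /=.
    move/fintype.subsetP => EV; apply/fintype.subsetP => x xE.
    have := EV _ (imset_f g xE); rewrite !inE.
    by case: x {xE} => //= v; rewrite ffunE.
  apply/imsetP; exists (Sub E Ecell) => //; apply/val_inj; rewrite /= FE.
  by congr multi_img.
rewrite big_imset /=; last by move=> ? ? _ _; exact: face_cell_inj.
apply: eq_big => [E|E _]; first by rewrite inE.
by rewrite ffunE (tcobd_img R g_inj g_lt).
Qed.

End RegularFaces.

Local Open Scope classical_set_scope.

Lemma ereal_int_supremums (A : set (\bar int)) : A !=set0 -> supremums A !=set0.
Proof.
move=> [a Aa].
have [Ay|Ay] := pselect (A +oo%E).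
  by exists +oo%E; split => [x _|x /(_ _ Ay)//]; rewrite leey.
have [[m Am]|noA] := pselect (exists m : int, A m%:E); last first.
  exists -oo%E; split => [[x| |] Ax|x _]; rewrite ?leNye//.
  by case: noA; exists x.
have [[M AM]|unb] := pselect (exists M : int, forall x : int, A x%:E -> x <= M).
  pose P (k : nat) := `[< A (m + k%:Z)%:E >].
  have exP : exists k, P k by exists 0%N; apply/asboolP; rewrite addr0.
  have ubP k : P k -> (k <= `|M - m|)%N.
    move=> /asboolP/AM; have := AM _ Am; lia.
  case: (ex_maxnP exP ubP) => k /asboolP Ak kmax.
  exists (m + k%:Z)%:E; split => [[x| |] Ax|x /(_ _ Ak)//]; rewrite ?leNye//.
  rewrite lee_fin; have [xm|mx] := lerP x m; first by lia.
  have /kmax : P `|x - m|%N.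
    by apply/asboolP; rewrite (_ : m + _ = x) //; lia.
  by lia.
exists +oo%E; split => [x _|[x| |] Ax]; rewrite ?leey// ?leye_eq//.
  by case: unb; exists x => y /Ax; rewrite lee_fin.
by have := Ax _ Am; rewrite leeNy_eq.
Qed.

Lemma supremum_le (A : set (\bar int)) (y : \bar int) :
  (supremum -oo%E A <= y)%E <-> (forall x, A x -> (x <= y)%E).
Proof.
split=> [h x Ax|h].
  apply: le_trans h; have A0 : A !=set0 by exists x.
  rewrite /supremum ifF; last by apply/negbTE/set0P.
  have := xgetPex -oo%E (ereal_int_supremums A0).
  by case=> + _; apply.
have [->|/set0P A0] := eqVneq A set0; first by rewrite supremum0 leNye.
rewrite /supremum ifF; last by apply/negbTE/set0P.
by have := xgetPex -oo%E (ereal_int_supremums A0); case=> _; apply.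
Qed.

Section PerverseDegree.
Variables (R : comPzRingType) (n m : nat) (b : {ffun 'I_m.+1 -> 'I_n.+1}).

(* ||1_(F,ε)||_l *)
Definition cell_pdeg (l k : nat) (E : cell b k) : \bar int :=
  if None \in val E (inord (n - l)) then -oo%E
  else ((\sum_(i < n.+1 | (n - l < i)%N) sdim (val E i))%N%:Z)%:E.

Definition pdeg (l k : nat) (w : bcochain R b k) : \bar int :=
  \big[maxe/-oo%E]_(E : cell b k | w E != 0) cell_pdeg l E.

Lemma pdeg_le l k (w : bcochain R b k) (y : \bar int) :
  (pdeg l w <= y)%E <-> (forall E, w E != 0 -> (cell_pdeg l E <= y)%E).
Proof.
split=> [h E wE|h]; last first.
  apply: (big_ind (fun u => (u <= y)%E)) => [|u v uy vy|E /h//].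
    by rewrite leNye.
  by rewrite ge_max uy.
apply: le_trans h; rewrite /pdeg (bigD1 E) //=.
by rewrite le_max lexx.
Qed.

Lemma pdeg0 l k : pdeg l (0 : bcochain R b k) = -oo%E.
Proof. by rewrite /pdeg big1 // => E; rewrite ffunE eqxx. Qed.

Lemma pdeg_lin l k (a : R) (w w' : bcochain R b k) (y : \bar int) :
  (pdeg l w <= y)%E -> (pdeg l w' <= y)%E -> (pdeg l (a *: w + w')%R <= y)%E.
Proof.
move=> /pdeg_le h /pdeg_le h'; apply/pdeg_le => E; rewrite !ffunE => nz.
have [w0|] := eqVneq (w E) 0; last exact: h.
by apply: h'; apply: contra_neq nz => ->; rewrite w0 scaler0 addr0.
Qed.

End PerverseDegree.

Definition prev_skel T (sk : nat -> set T) (i : nat) : set T :=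
  if i is j.+1 then sk j else set0.

(* X_i \ X_(i-1) *)
Definition layer T (sk : nat -> set T) (i : nat) : set T :=
  sk i `\` prev_skel sk i.

Definition stratum (T : topologicalType) (sk : nat -> set T) (i : nat) (S : set T) :=
  exists2 x, layer sk i x & S = connected_component (layer sk i) x.

(* skel i is X_i; it is X for i >= n.  Only the values of perv on strata are ever
   used.  The condition X_(n-1) <> X_n is kept apart (as a hypothesis on X):
   an open subset of X may lie in X_(n-1), in which case it has no regular
   simplex and its complexes are 0. *)
Record perverse_space (n : nat) := PerverseSpace {
  ps_space :> topologicalType;
  skel : nat -> set ps_space;
  perv : set ps_space -> \bar int;
  ps_hausdorff : hausdorff_space ps_space;
  skel_closed : forall i, closed (skel i);
  skelS : forall i, skel i `<=` skel i.+1;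
  skel_top : skel n = setT;
  perv_regular : forall S, stratum skel n S -> perv S = 0%E }.

Arguments skel {n} X i : rename.

Lemma skel_le n (X : perverse_space n) i j : (i <= j)%N ->
  skel X i `<=` skel X j.
Proof.
move=> /subnK <-; elim: (j - i)%N => // k IH.
by apply: subset_trans IH _; rewrite addSn; exact: skelS.
Qed.

Lemma layer_inj n (X : perverse_space n) i j x :
  layer (skel X) i x -> layer (skel X) j x -> i = j.
Proof.
wlog ij : i j / (i <= j)%N.
  by move=> h Li Lj; case: (leqP i j) => [|/ltnW] ij; [|apply: esym]; exact: h.
move: ij; rewrite leq_eqVlt => /predU1P[//|]; case: j => // j ij [si _] [_ sj].
by exfalso; apply: sj; exact: (skel_le (ij : (i <= j)%N)).
Qed.

Lemma stratum_sub n (X : perverse_space n) i S : stratum (skel X) i S ->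
  S `<=` layer (skel X) i.
Proof. by case=> x _ ->; exact: connected_component_sub. Qed.

Lemma stratum_eq n (X : perverse_space n) i S j S' x :
  stratum (skel X) i S -> stratum (skel X) j S' -> S x -> S' x ->
  i = j /\ S = S'.
Proof.
move=> iS jS' Sx S'x.
have ij : i = j.
  apply: (@layer_inj _ X _ _ x); first exact: stratum_sub iS _ _.
  exact: stratum_sub jS' _ _.
split=> //; case: iS jS' Sx S'x => y _ -> [z _ ->] yx zx; rewrite -ij in zx *.
by rewrite (same_connected_component yx) (same_connected_component zx).
Qed.

Lemma stratum_img (T : topologicalType) n (X : perverse_space n)
    (sk : nat -> set T) (g : T -> X) i S :
  continuous g -> (forall j, sk j = g @^-1` skel X j) -> stratum sk i S ->
  exists2 S', stratum (skel X) i S' & g @` S `<=` S'.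
Proof.
move=> gc gsk [x Lx ->].
have gL : layer sk i = g @^-1` layer (skel X) i.
  by rewrite /layer gsk; case: i {Lx} => [|i] /=; rewrite ?gsk.
exists (connected_component (layer (skel X) i) (g x)).
  by exists (g x) => //; move: Lx; rewrite gL.
apply: connected_component_max.
- by exists x => //; exact: connected_component_refl.
- by move=> _ [y /connected_component_sub + <-]; rewrite gL.
- apply: connected_continuous_connected; first exact: component_connected.
  exact: continuous_subspaceT.
Qed.

Section OpenSubspace.
Variables (n : nat) (X : perverse_space n) (U : set X).

Let T : topologicalType := set_type U.

Definition sub_skel (i : nat) : set T := \val @^-1` skel X i.

(* The stratum of X containing the stratum S of U. *)
Definition stratum_containing (S : set T) : set X :=
  xget set0 [set S' | (exists i, stratum (skel X) i S') /\ \val @` S `<=` S'].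

Lemma val_continuous : continuous (\val : T -> X).
Proof. by rewrite -set_valE; exact: initial_continuous. Qed.

Lemma stratum_containingP i S : stratum sub_skel i S ->
  stratum (skel X) i (stratum_containing S) /\
  \val @` S `<=` stratum_containing S.
Proof.
move=> iS; have [S' iS' SS'] := stratum_img val_continuous (fun=> erefl) iS.
rewrite /stratum_containing.
set D := [set _ | _]; have : D (xget set0 D).
  by apply: xgetPex; exists S'; split => //; exists i.
set S'' := xget _ _ => -[[j jS'']] SS''; split=> //.
case: iS SS' SS'' => x Lx -> SS' SS''.
have Sx : (\val @` connected_component (layer sub_skel i) x) (\val x).
  by exists x => //; exact: connected_component_refl.
by have [_ <-] := stratum_eq iS' jS'' (SS' _ Sx) (SS'' _ Sx).
Qed.

Lemma sub_hausdorff : hausdorff_space T.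
Proof.
move=> p q pq; apply: val_inj; apply: (@ps_hausdorff _ X) => A B.
move=> /val_continuous Ap /val_continuous Bq.
by have [z [Az Bz]] := pq _ _ Ap Bq; exists (\val z).
Qed.

Lemma sub_skel_closed i : closed (sub_skel i).
Proof.
by apply: closed_comp; [move=> ? _; exact: val_continuous|exact: skel_closed].
Qed.

Lemma sub_skelS i : sub_skel i `<=` sub_skel i.+1.
Proof. by move=> x; exact: skelS. Qed.

Lemma sub_skel_top : sub_skel n = setT.
Proof. by rewrite /sub_skel skel_top. Qed.

Lemma sub_perv_regular S : stratum sub_skel n S ->
  perv (stratum_containing S) = 0%E.
Proof. by move=> /stratum_containingP[/perv_regular ->]. Qed.

Definition subspace_of : perverse_space n :=
  @PerverseSpace n T sub_skel (fun S => perv (stratum_containing S))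
    sub_hausdorff sub_skel_closed sub_skelS sub_skel_top sub_perv_regular.

End OpenSubspace.

(* Continuous maps compatible with the filtrations and the perversities, such as
   the inclusions of open subsets. *)
Record perverse_map n (Y X : perverse_space n) := PerverseMap {
  pm_fun :> Y -> X;
  pm_continuous : continuous pm_fun;
  pm_skel : forall i, skel Y i = pm_fun @^-1` skel X i;
  pm_perv : forall i S S', stratum (skel Y) i S -> stratum (skel X) i S' ->
    pm_fun @` S `<=` S' -> perv S = perv S' }.

Section Inclusions.
Variables (n : nat) (X : perverse_space n).

Lemma incl_perv (U : set X) i (S : set (subspace_of U)) S' :
  stratum (skel (subspace_of U)) i S -> stratum (skel X) i S' ->
  \val @` S `<=` S' -> perv S = perv S'.
Proof.
move=> iS iS' SS'; have [iC SC] := stratum_containingP iS.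
have [x Lx E] := iS; have Sx : (\val @` S) (\val x).
  by exists x => //; rewrite E; exact: connected_component_refl.
by have [_ /= ->] := stratum_eq iC iS' (SC _ Sx) (SS' _ Sx).
Qed.

Definition incl_map (U : set X) : perverse_map (subspace_of U) X :=
  @PerverseMap n (subspace_of U) X \val (@val_continuous n X U) (fun=> erefl)
    (@incl_perv U).

Definition incl_sub_fun (V U : set X) (VU : V `<=` U) (x : subspace_of V) :
  subspace_of U := SigSub (mem_set (VU _ (set_mem (valP x)))).

Lemma incl_sub_continuous V U (VU : V `<=` U) : continuous (incl_sub_fun VU).
Proof.
apply/continuousP => A [B oB <-].
have -> : incl_sub_fun VU @^-1` (set_val @^-1` B) = \val @^-1` B.
  by rewrite set_valE.
move/continuousP: (@val_continuous n X V); exact.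
Qed.

Lemma incl_sub_perv V U (VU : V `<=` U) i S S' :
  stratum (skel (subspace_of V)) i S -> stratum (skel (subspace_of U)) i S' ->
  incl_sub_fun VU @` S `<=` S' -> perv S = perv S'.
Proof.
move=> iS iS' SS'; have [iC SC] := stratum_containingP iS.
have [iC' SC'] := stratum_containingP iS'.
have [x Lx E] := iS; have Sx : S x.
  by rewrite E; exact: connected_component_refl.
have S'x : S' (incl_sub_fun VU x) by apply: SS'; exists x.
have [_ /= -> //] := stratum_eq iC iC' (SC _ (imageP _ Sx)) (SC' _ (imageP _ S'x)).
Qed.

Definition incl_sub V U (VU : V `<=` U) :
    perverse_map (subspace_of V) (subspace_of U) :=
  PerverseMap (@incl_sub_continuous V U VU) (fun=> erefl) (@incl_sub_perv V U VU).

End Inclusions.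

Section DependentFunctions.
Variables (R : pzRingType) (I : Type) (M : I -> lmodType R).

Definition dep_fun : Type := forall i, M i.
Implicit Types f g h : dep_fun.

HB.instance Definition _ := gen_eqMixin dep_fun.
HB.instance Definition _ := gen_choiceMixin dep_fun.

Let add f g : dep_fun := fun i => f i + g i.
Let opp f : dep_fun := fun i => - f i.
Let zero : dep_fun := fun=> 0.
Let scale (a : R) f : dep_fun := fun i => a *: f i.

Let addA : associative add.
Proof. by move=> f g h; apply: functional_extensionality_dep => i; exact: addrA. Qed.
Let addC : commutative add.
Proof. by move=> f g; apply: functional_extensionality_dep => i; exact: addrC. Qed.
Let add0 : left_id zero add.
Proof. by move=> f; apply: functional_extensionality_dep => i; exact: add0r. Qed.
Let addN : left_inverse zero opp add.
Proof. by move=> f; apply: functional_extensionality_dep => i; exact: addNr. Qed.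

HB.instance Definition _ := GRing.isZmodule.Build dep_fun addA addC add0 addN.

Let scaleA a b f : scale a (scale b f) = scale (a * b) f.
Proof. by apply: functional_extensionality_dep => i; exact: scalerA. Qed.
Let scale1 : left_id 1 scale.
Proof. by move=> f; apply: functional_extensionality_dep => i; exact: scale1r. Qed.
Let scaleDr : right_distributive scale +%R.
Proof. by move=> a f g; apply: functional_extensionality_dep => i; exact: scalerDr. Qed.
Let scaleDl f : {morph scale^~ f : a b / a + b}.
Proof. by move=> a b; apply: functional_extensionality_dep => i; exact: scalerDl. Qed.

HB.instance Definition _ :=
  GRing.Zmodule_isLmodule.Build R dep_fun scaleA scale1 scaleDr scaleDl.

End DependentFunctions.

Section CochainComplexes.
Variable R : pzRingType.

Record cochain_complex := CochainComplex {
  coch :> nat -> lmodType R;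
  cobdry : forall k, {linear coch k -> coch k.+1};
  cobdryK : forall k (x : coch k), cobdry k.+1 (cobdry k x) = 0 }.

Record cochain_map (A B : cochain_complex) := CochainMap {
  cmap :> forall k, {linear A k -> B k};
  cmap_cobdry : forall k (x : A k), 
    cmap k.+1 (cobdry A k x) = cobdry B k (cmap k x) }.

Section DirectSum.
Variables A B : cochain_complex.

Definition sum_cobdry k (x : A k * B k) : A k.+1 * B k.+1 :=
  (cobdry A k x.1, cobdry B k x.2).

Fact sum_cobdry_is_linear k : linear (@sum_cobdry k).
Proof. by move=> a x y; rewrite /sum_cobdry !linearP. Qed.

HB.instance Definition _ k := GRing.isLinear.Build R (A k * B k)%type
  (A k.+1 * B k.+1)%type _ (@sum_cobdry k) (@sum_cobdry_is_linear k).

Fact sum_cobdryK k x : sum_cobdry (@sum_cobdry k x) = 0.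
Proof. by rewrite /sum_cobdry /= !cobdryK. Qed.

Definition direct_sum : cochain_complex :=
  @CochainComplex (fun k => (A k * B k)%type) _ sum_cobdryK.

End DirectSum.

Section PairDiff.
Variables A B C : cochain_complex.

Section Pair.
Variables (f : cochain_map A B) (g : cochain_map A C).

Definition pair_fun k (x : A k) : direct_sum B C k := (f k x, g k x).

Fact pair_fun_is_linear k : linear (@pair_fun k).
Proof. by move=> a x y; rewrite /pair_fun !linearP. Qed.

HB.instance Definition _ k :=
  GRing.isLinear.Build R (A k) (direct_sum B C k) _ (@pair_fun k)
    (@pair_fun_is_linear k).

Fact pair_fun_cobdry k x :
  pair_fun (cobdry A k x) = cobdry (direct_sum B C) k (pair_fun x).
Proof. by rewrite /pair_fun !cmap_cobdry. Qed.

Definition pair_map : cochain_map A (direct_sum B C) :=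
  @CochainMap A (direct_sum B C) (fun k => @pair_fun k) pair_fun_cobdry.
End Pair.

Section Diff.
Variables (f : cochain_map A C) (g : cochain_map B C).

Definition diff_fun k (x : direct_sum A B k) : C k := f k x.1 - g k x.2.

Fact diff_fun_is_linear k : linear (@diff_fun k).
Proof.
move=> a x y; rewrite /diff_fun [(_ + _).1]/= [(_ + _).2]/= !linearP.
by rewrite /= scalerDr addrACA.
Qed.

HB.instance Definition _ k :=
  GRing.isLinear.Build R (direct_sum A B k) (C k) _ (@diff_fun k)
    (@diff_fun_is_linear k).

Fact diff_fun_cobdry k x :
  diff_fun (cobdry (direct_sum A B) k x) = cobdry C k (diff_fun x).
Proof. by rewrite /diff_fun linearB !cmap_cobdry. Qed.

Definition diff_map : cochain_map (direct_sum A B) C :=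
  @CochainMap (direct_sum A B) C (fun k => @diff_fun k) diff_fun_cobdry.
End Diff.

End PairDiff.

Definition short_exact (A B C : cochain_complex) (f : cochain_map A B)
    (g : cochain_map B C) : Prop :=
  forall k, [/\ injective (f k), range (f k) = g k @^-1` [set 0]
             & range (g k) = setT].

End CochainComplexes.

Section Simplices.
Variable K : realType.

(* Every euclidean simplex with ordered vertices is uniquely identified with a
   standard one; families are indexed by maps defined on standard simplices. *)
Definition std_simplex (m : nat) : set 'rV[K]_m.+1 :=
  [set t | (forall v, 0 <= t 0 v) /\ \sum_v t 0 v = 1].
Arguments std_simplex : clear implicits.

Definition face_point m (l : 'I_m.+2) (t : 'rV[K]_m.+1) : 'rV[K]_m.+2 :=
  \row_v (if unlift l v is Some u then t 0 u else 0).

Fact face_point_simplex m (l : 'I_m.+2) (t : std_simplex m) :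
  std_simplex m.+1 (face_point l (\val t)).
Proof.
case: t => t /= /set_mem [t0 t1]; split.
  by move=> v; rewrite mxE; case: unliftP => [u _|_].
rewrite (bigD1_ord l) //= mxE unlift_none add0r -[RHS]t1.
by apply: eq_bigr => v _; rewrite mxE liftK.
Qed.

Definition face_incl m (l : 'I_m.+2) (t : std_simplex m) : std_simplex m.+1 :=
  SigSub (mem_set (face_point_simplex l t)).

(* P is the condition imposed on the images of the simplices: setT for all the
   regular simplices, small V for the V-small ones. *)
Section RegularSimplices.
Variables (n : nat) (X : perverse_space n) (P : set (set X)).

Record regular_simplex m (b : {ffun 'I_m.+1 -> 'I_n.+1}) := RegularSimplex {
  rs_map :> std_simplex m -> X;
  rs_continuous : continuous rs_map;
  rs_join : {homo b : u v / (u <= v)%N};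
  rs_filtered : forall (i : 'I_n.+1) t,
    skel X i (rs_map t) <-> (forall v, (i < b v)%N -> \val t 0 v = 0);
  rs_regular : exists v, b v = ord_max;
  rs_image : P (range rs_map) }.

Record simplex := Simplex {
  s_dim : nat;
  s_blocks : {ffun 'I_s_dim.+1 -> 'I_n.+1};
  s_map :> regular_simplex s_blocks }.

End RegularSimplices.

Section Blowup.
Variables (R : comPzRingType) (n : nat) (X : perverse_space n) (P : set (set X)).

Definition cochain_family (k : nat) : Type :=
  dep_fun (fun s : simplex P => bcochain R (s_blocks s) k).
HB.instance Definition _ k := GRing.Lmodule.on (cochain_family k).

Definition family_cobd k (w : cochain_family k) : cochain_family k.+1 :=
  fun s => bcobd (w s).

(* σ : Δ -> X and τ : ∇ -> X range over the index set of the family.  As ∇ carries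
   the induced blocks, τ = σ ∘ δ_l being in the index set forces ∇_n to be
   nonempty; and for a P inherited by subsets, every regular face of σ is in the
   index set.  So these are exactly the regular face operators. *)
Definition compatible k (w : cochain_family k) : Prop :=
  forall m (b : {ffun 'I_m.+2 -> 'I_n.+1}) (s : regular_simplex P b) (l : 'I_m.+2)
      (t : regular_simplex P (face_blocks b l)),
    rs_map t = rs_map s \o face_incl l ->
    face_pull l (w (Simplex s)) = w (Simplex t).

(* ||w||_S for a stratum S of codimension l; the supremum is taken in Z ∪ {±oo},
   and that of the empty set is -oo. *)
Definition stratum_pdeg k (w : cochain_family k) (l : nat) (S : set X) : \bar int :=
  supremum -oo%E
    [set pdeg l (w s) | s in [set s : simplex P | range s `&` S !=set0]].

Definition allowable k (w : cochain_family k) : Prop :=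
  forall i S, (i < n)%N -> stratum (skel X) i S ->
    (stratum_pdeg w (n - i) S <= perv S)%E.

Definition is_blowup_cochain k : {pred cochain_family k} := fun w =>
  `[< [/\ compatible w, allowable w & allowable (family_cobd w)] >].

Fact family_cobd_is_linear k : linear (@family_cobd k).
Proof.
move=> a w w'; apply: functional_extensionality_dep => s.
exact: bcobd_is_linear.
Qed.

Lemma family_cobdK k (w : cochain_family k) : family_cobd (family_cobd w) = 0.
Proof. by apply: functional_extensionality_dep => s; exact: bcobd_bcobd. Qed.

Lemma compatible_lin k a (w w' : cochain_family k) :
  compatible w -> compatible w' -> compatible (a *: w + w').
Proof.
move=> cw cw' m b s l t ts.
by rewrite [LHS]face_pull_is_linear (cw _ _ _ _ _ ts) (cw' _ _ _ _ _ ts).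
Qed.

Lemma compatible_cobd k (w : cochain_family k) :
  compatible w -> compatible (family_cobd w).
Proof.
by move=> cw m b s l t ts; rewrite [LHS]face_pull_bcobd (cw _ _ _ _ _ ts).
Qed.

Lemma allowableP k (w : cochain_family k) :
  allowable w <-> forall i S (s : simplex P), (i < n)%N -> stratum (skel X) i S ->
    range s `&` S !=set0 -> (pdeg (n - i) (w s) <= perv S)%E.
Proof.
split=> [h i S s ltin iS sS|h i S ltin iS].
  by have /supremum_le := h i S ltin iS; apply; exists s.
by apply/supremum_le => _ [s sS <-]; exact: h.
Qed.

Lemma allowable_lin k a (w w' : cochain_family k) :
  allowable w -> allowable w' -> allowable (a *: w + w').
Proof.
move=> /allowableP h /allowableP h'; apply/allowableP => i S s ltin iS sS.
by apply: pdeg_lin; [exact: h|exact: h'].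
Qed.

Lemma allowable0 k : allowable (0 : cochain_family k).
Proof.
by apply/allowableP => i S s _ _ _; rewrite [X in (X <= _)%E]pdeg0 leNye.
Qed.

Fact is_blowup_cochain_closed k : submod_closed (@is_blowup_cochain k).
Proof.
split.
  apply/asboolP; split; [|exact: allowable0|].
    by move=> m b s l t _; apply/ffunP => E; rewrite !ffunE.
  rewrite (_ : family_cobd _ = 0); first exact: allowable0.
  apply: functional_extensionality_dep => s; apply/ffunP => G.
  by rewrite !ffunE big1 // => F _; rewrite ffunE mul0r.
move=> a w w' /asboolP[cw aw dw] /asboolP[cw' aw' dw']; apply/asboolP; split.
- exact: compatible_lin.
- exact: allowable_lin.
- by rewrite family_cobd_is_linear; exact: allowable_lin.
Qed.

Record blowup_cochain (k : nat) := BlowupCochain {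
  bc_family :> cochain_family k;
  bc_in : bc_family \in @is_blowup_cochain k }.

HB.instance Definition _ k := [isSub for @bc_family k].
HB.instance Definition _ k := [Choice of blowup_cochain k by <:].
HB.instance Definition _ k := GRing.SubChoice_isSubLmodule.Build R (cochain_family k)
  (@is_blowup_cochain k) (blowup_cochain k) (is_blowup_cochain_closed k).

Fact blowup_cobd_in k (w : blowup_cochain k) :
  family_cobd w \in @is_blowup_cochain k.+1.
Proof.
have /asboolP[cw aw dw] := bc_in w; apply/asboolP; split => //.
  exact: compatible_cobd.
by rewrite family_cobdK; exact: allowable0.
Qed.

Definition blowup_cobd k (w : blowup_cochain k) : blowup_cochain k.+1 :=
  BlowupCochain (blowup_cobd_in w).

Fact blowup_cobd_is_linear k : linear (@blowup_cobd k).
Proof. by move=> a w w'; apply: val_inj; exact: family_cobd_is_linear. Qed.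

HB.instance Definition _ k := GRing.isLinear.Build R (blowup_cochain k)
  (blowup_cochain k.+1) _ (@blowup_cobd k) (@blowup_cobd_is_linear k).

Fact blowup_cobdK k (w : blowup_cochain k) : blowup_cobd (blowup_cobd w) = 0.
Proof. by apply: val_inj; exact: family_cobdK. Qed.

Definition blowup_complex : cochain_complex R :=
  @CochainComplex R (fun k => blowup_cochain k) (fun k => @blowup_cobd k)
    blowup_cobdK.

End Blowup.

Section Restriction.
Variables (R : comPzRingType) (n : nat) (Y X : perverse_space n).
Variables (Q : set (set Y)) (P : set (set X)) (g : perverse_map Y X).
Hypothesis QP : forall A, Q A -> P (g @` A).

Section Push.
Variables (m : nat) (b : {ffun 'I_m.+1 -> 'I_n.+1}) (s : regular_simplex Q b).

Fact push_continuous : continuous (g \o s).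
Proof.
move=> t; apply: continuous_comp; first exact: rs_continuous.
exact: pm_continuous.
Qed.

Fact push_filtered (i : 'I_n.+1) t :
  skel X i ((g \o s) t) <-> (forall v, (i < b v)%N -> \val t 0 v = 0).
Proof. by rewrite -(rs_filtered s) (pm_skel g). Qed.

Fact push_image : P (range (g \o s)).
Proof. by rewrite -(image_comp s g); apply: QP; exact: rs_image s. Qed.

Definition push : regular_simplex P b :=
  RegularSimplex push_continuous (@rs_join _ _ _ _ _ s) push_filtered
    (rs_regular s) push_image.
End Push.

Definition pull k (w : cochain_family R P k) : cochain_family R Q k :=
  fun s => w (Simplex (push s)).

Fact pull_in k (w : blowup_cochain R P k) :
  pull w \in @is_blowup_cochain R n Y Q k.
Proof.
have al j (u : cochain_family R P j) : allowable u -> allowable (pull u).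
  move=> /allowableP h; apply/allowableP => i S s ltin iS [y [[t _ sty] Sy]].
  have [S' iS' SS'] := stratum_img (@pm_continuous _ _ _ g) (@pm_skel _ _ _ g) iS.
  rewrite (pm_perv iS iS' SS'); apply: (h i S' (Simplex (push s))) => //.
  by exists (g y); split; [exists t => //=; rewrite sty|apply: SS'; exists y].
have /asboolP[cw aw dw] := bc_in w; apply/asboolP; split.
- by move=> m b s l t ts; apply: cw => /=; rewrite ts.
- exact: al.
- exact: al dw.
Qed.

Definition restr_fun k (w : blowup_cochain R P k) : blowup_cochain R Q k :=
  BlowupCochain (pull_in w).

Fact restr_fun_is_linear k : linear (@restr_fun k).
Proof. by move=> a w w'; exact: val_inj. Qed.

HB.instance Definition _ k := GRing.isLinear.Build R (blowup_cochain R P k)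
  (blowup_cochain R Q k) _ (@restr_fun k) (@restr_fun_is_linear k).

Fact restr_fun_cobdry k (w : blowup_complex R P k) :
  restr_fun (cobdry _ k w) = cobdry (blowup_complex R Q) k (restr_fun w).
Proof. exact: val_inj. Qed.

(* (restr w)_σ = w_(g ∘ σ) *)
Definition restr : cochain_map (blowup_complex R P) (blowup_complex R Q) :=
  @CochainMap R (blowup_complex R P) (blowup_complex R Q)
    (fun k => @restr_fun k) restr_fun_cobdry.

End Restriction.
End Simplices.

Section MayerVietoris.
Variables (K : realType) (R : comPzRingType) (n : nat).

Definition paracompact (T : topologicalType) : Prop :=
  hausdorff_space T /\
  forall V : set (set T),
    (forall A, V A -> open A) -> \bigcup_(A in V) A = setT ->
    exists W : set (set T),
      [/\ (forall B, W B -> open B), \bigcup_(B in W) B = setT,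
          (forall B, W B -> exists2 A, V A & B `<=` A)
        & forall x : T, exists2 N, nbhs x N &
            finite_set [set B | W B /\ B `&` N !=set0]].

Definition subordinate_partition (T : topologicalType) (U1 U2 : set T)
    (f1 f2 : T -> K) : Prop :=
  [/\ continuous f1 /\ continuous f2,
      forall x, 0 <= f1 x /\ 0 <= f2 x,
      forall x, f1 x + f2 x = 1,
      closure [set x | f1 x != 0] `<=` U1
    & closure [set x | f2 x != 0] `<=` U2].

Definition small T (V : set (set T)) : set (set T) :=
  [set A | exists2 B, V B & A `<=` B].

Definition blowup (X : perverse_space n) : cochain_complex R :=
  blowup_complex K R [set: set X].

Definition small_blowup (X : perverse_space n) (V : set (set X)) :
  cochain_complex R := blowup_complex K R (small V).

Variable X : perverse_space n.

(* The sets of V seen in the subspace U. *)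
Definition trace_cover (U : set X) (V : set (set X)) : set (set (subspace_of U)) :=
  [set \val @^-1` A | A in V].
Arguments trace_cover : clear implicits.

Lemma small_trace (U : set X) (V W : set (set X)) : V `<=` W ->
  forall A, small (trace_cover U V) A -> small W (incl_map U @` A).
Proof.
move=> VW A [_ [B VB <-] AB]; exists B; first exact: VW.
by move=> _ [x /AB ? <-].
Qed.

Lemma incl_sub_small (W U : set X) (V : set (set X)) (WU : W `<=` U) :
  V W -> forall A, [set: set (subspace_of W)] A ->
  small (trace_cover U V) (incl_sub WU @` A).
Proof.
move=> VW A _; exists (\val @^-1` W); first by exists W.
by move=> _ [x _ <-] /=; exact: set_mem (valP x).
Qed.

Variables (U1 U2 : set X) (f1 f2 : X -> K).

(* The covers of U_1, U_2 (as families of subsets of X) and of X. *)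
Definition mv_cover1 : set (set X) := [set U1 `&` U2; f1 @^-1` `]1 / 2, 1]].
Definition mv_cover2 : set (set X) := [set U1 `&` U2; f2 @^-1` `]1 / 2, 1]].
Definition mv_cover : set (set X) := mv_cover1 `|` mv_cover2.

(* w |-> (w restricted to U1, w restricted to U2) *)
Definition mv_iota : cochain_map (small_blowup mv_cover)
    (direct_sum (small_blowup (trace_cover U1 mv_cover1))
                (small_blowup (trace_cover U2 mv_cover2))) :=
  pair_map (restr K R (small_trace (@subsetUl _ mv_cover1 mv_cover2)))
           (restr K R (small_trace (@subsetUr _ mv_cover1 mv_cover2))).

(* (w1, w2) |-> w1 - w2 restricted to U1 ∩ U2 *)
Definition mv_phi :
  cochain_map (direct_sum (small_blowup (trace_cover U1 mv_cover1))
                          (small_blowup (trace_cover U2 mv_cover2)))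
              (blowup (subspace_of (U1 `&` U2))) :=
  diff_map
    (restr K R (@incl_sub_small (U1 `&` U2) U1 mv_cover1 (@subIsetl _ U1 U2)
                  (or_introl erefl)))
    (restr K R (@incl_sub_small (U1 `&` U2) U2 mv_cover2 (@subIsetr _ U1 U2)
                  (or_introl erefl))).

End MayerVietoris.

(* Main.v *)
Require Import Defs.
From mathcomp Require Import all_boot all_order all_algebra.
From mathcomp Require Import lra.
From mathcomp Require Import all_classical all_reals all_analysis.
Set Implicit Arguments.
Unset Strict Implicit.
Unset Printing Implicit Defensive.
Import Order.TTheory GRing.Theory Num.Theory.
Import numFieldNormedType.Exports.
Local Open Scope classical_set_scope.
Local Open Scope ring_scope.

(** Surjectivity of the difference is the point; the rest is gluing.  A cochain
    [w] of [U1 ∩ U2] has to be split as a cochain that vanishes on the simplices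
    of [f1 > 1/2] plus one that vanishes on those of [f2 > 1/2]: the first then
    extends by zero to the small simplices of [U1] and the second to those of
    [U2].  The splitting is the cup product with the two 0-cochains defined by
    the characteristic function [h] of [f1 <= 1/2] and by [1 - h].  What has
    to be shown is that the 0-cochain of [h] is mild enough for the product to
    preserve allowability, also after the differential.

    A basis element [1_(F,ε)] is a product of faces of the cones on the joinands.
    Its least vertex that is not an apex is called its lead, and the product with
    [h] multiplies the coefficient of a simplex [σ] on [1_(F,ε)] by the value of
    [h] at the image under [σ] of the lead.  This commutes with regular faces
    ([lead_face]).  The differential of the product differs from the product with
    the differential only through pairs [F], [G] where [1_G] occurs in [δ 1_F] and
    the leads differ.  If the factor of [G] of index [n - l] has no apex, then the
    lead of [G] lies in a factor of index at most [n - l] ([lead_prefix]), so the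
    leads differ only when [F] and [G] agree beyond [n - l]; hence [1_G] has
    perverse degree at most that of [1_F] ([cell_pdeg_cobd],
    [pdeg_bcobd_vprod]).

    Compatibility with faces and allowability can be tested on any family of
    subspaces such that each simplex of the index set lies in one of them
    ([blowup_local]).  Every small simplex of [X] is a small simplex of [U1] or of
    [U2], which gives exactness on the left and in the middle ([mv_iota_inj],
    [mv_glue]), and the same principle shows that extensions by zero are blow-up
    cochains ([extend_by_zero], [mv_phi_surj]). *)

(** * The lead of a basis element *)

Section LeadVertex.
Variables (n m : nat) (b : {ffun 'I_m.+1 -> 'I_n.+1}).
Implicit Types E F G : {ffun 'I_n.+1 -> {set option 'I_m.+1}}.

Definition vertices E : {set 'I_m.+1} := \bigcup_i Some @^-1: E i.

Definition is_lead E v := (v \in vertices E) && [forall w in vertices E, (v <= w)%N].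

Definition lead E : 'I_m.+1 := odflt ord0 [pick v | is_lead E v].

Lemma verticesP E v : reflect (exists i, Some v \in E i) (v \in vertices E).
Proof.
apply: (iffP bigcupP) => [[i _]|[i vE]]; first by rewrite inE; exists i.
by exists i; rewrite ?inE.
Qed.

Lemma lead_eq E v : is_lead E v -> lead E = v.
Proof.
rewrite /lead => /andP[vE /forall_inP vmin]; case: pickP => /= [w|/(_ v)].
  case/andP=> wE /forall_inP wmin; apply/val_inj/eqP.
  by rewrite eqn_leq vmin // wmin.
by rewrite /is_lead vE; move/forall_inP: vmin => ->.
Qed.

Lemma leadP k E : is_cell b k E -> is_lead E (lead E).
Proof.
case/andP=> /forallP /(_ ord_max)/andP[/set0Pn[x xE] /fintype.subsetP EV] _.
have [v Ev] : exists v, v \in vertices E.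
  have := EV _ xE; rewrite inE; case: x xE => [v vE _|]; last by rewrite eqxx.
  by exists v; apply/verticesP; exists ord_max.
have L : exists v, is_lead E v.
  case: (@arg_minnP _ v (mem (vertices E)) (fun w => nat_of_ord w) Ev) => w wE wmin.
  by exists w; apply/andP; split=> //; apply/forall_inP.
by case: L => w wL; rewrite (lead_eq wL).
Qed.

Lemma cell_mem k E i v : is_cell b k E -> Some v \in E i -> b v = i.
Proof.
case/andP=> /forallP /(_ i)/andP[_ /fintype.subsetP EV] _ /EV.
by rewrite inE => /eqP.
Qed.

Hypothesis b_mono : {homo b : u v / (u <= v)%N}.

(** Blocks are listed in the vertex order, so the lead is a vertex of the first
    factor that is not reduced to an apex.  As the factor [G j] contains a vertex,
    this factor of [G] has index at most [j], where [F] and [G] coincide. *)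
Lemma lead_prefix k k' F G (j : 'I_n.+1) :
  is_cell b k F -> is_cell b k' G -> None \notin G j ->
  (forall i, F i \subset G i) -> (forall i : 'I_n.+1, (i <= j)%N -> F i = G i) ->
  lead F = lead G.
Proof.
move=> cF cG Gj FG E; have /andP[/verticesP[i vG] /forall_inP vmin] := leadP cG.
apply: lead_eq; apply/andP; split.
  apply/verticesP; exists i; rewrite E //.
  have /andP[/forallP /(_ j)/andP[/set0Pn[[w wG|NG] _] _]] := cG; last first.
    by rewrite NG in Gj.
  rewrite -(cell_mem cG vG) -(cell_mem cG wG); apply: b_mono; apply: vmin.
  by apply/verticesP; exists j.
apply/forall_inP => w /verticesP[i' wF]; apply: vmin; apply/verticesP.
by exists i'; exact: fintype.subsetP (FG i') _ wF.
Qed.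

End LeadVertex.

(** Each term of the tensor product differential changes a single factor. *)
Lemma tcobd_differ (R : comPzRingType) (V : finType) (lt : rel V) N
    (F G : {ffun 'I_N -> {set V}}) : tcobd R lt F G != 0 ->
  exists i, forall j, j != i -> F j = G j.
Proof.
case/tcobd_P => i P0; exists i => j ji; apply/eqP.
apply: contraNT P0 => FG; rewrite (bigD1 j) //= (negbTE ji).
by rewrite /ind [G j == F j]eq_sym (negbTE FG) mul0r.
Qed.

(** * The product with a vertex function *)

Section VertexProduct.
Variables (R : comPzRingType) (n m : nat) (b : {ffun 'I_m.+1 -> 'I_n.+1}).
Implicit Types a : 'I_m.+1 -> R.

(** The cup product of [w] with the 0-cochain whose value on [1_E] is the value of
    [a] at the lead of [E]: the front face of [E] in the cup product consists of
    the first vertices of its factors, and it has the same lead as [E]. *)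
Definition vprod a k (w : bcochain R b k) : bcochain R b k :=
  [ffun E => a (lead (val E)) * w E].

Lemma pdeg_vprod a k (w : bcochain R b k) l y :
  (pdeg l w <= y)%E -> (pdeg l (vprod a w) <= y)%E.
Proof.
move=> /pdeg_le h; apply/pdeg_le => E; rewrite ffunE => nz; apply: h.
by apply: contra_neq nz => ->; rewrite mulr0.
Qed.

Hypothesis b_mono : {homo b : u v / (u <= v)%N}.

(** If the factor of index [n - l] of [G] has no apex, a change of lead forces the
    factor modified by the differential to have index at most [n - l], and the
    degree only counts the factors beyond. *)
Lemma cell_pdeg_cobd k (F : cell b k) (G : cell b k.+1) l :
  tcobd R (@clt _) (val F) (val G) != 0 -> lead (val F) != lead (val G) ->
  (cell_pdeg l G <= cell_pdeg l F)%E.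
Proof.
move=> FG lFG; rewrite /cell_pdeg; have [_|NG] := ifPn; first exact: leNye.
rewrite ifN; last by apply: contra NG; exact: fintype.subsetP (tcobd_sub FG _) _.
have [i FGi] := tcobd_differ FG.
have jE : (inord (n - l) : 'I_n.+1) = (n - l)%N :> nat.
  by rewrite inordK // ltnS leq_subr.
have [ij|ji] := leqP i (n - l)%N.
  rewrite lee_fin (eq_bigr (fun j => sdim (val F j))) // => j jl; rewrite FGi //.
  by apply: contraTneq jl => ->; rewrite -leqNgt.
case/eqP: lFG; apply: lead_prefix (valP F) (valP G) NG (tcobd_sub FG) _ => //.
move=> j; rewrite jE => jl; apply: FGi; apply: contraTneq jl => ->.
by rewrite -ltnNge.
Qed.

(** Leibniz rule: what separates [δ(a w)] from [a (δ w)] is a sum over the [F] with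
    a lead other than that of [G], weighted by differences of values of [a]. *)
Lemma pdeg_bcobd_vprod a k (w : bcochain R b k) l y :
  (pdeg l w <= y)%E -> (pdeg l (bcobd w) <= y)%E ->
  (pdeg l (bcobd (vprod a w)) <= y)%E.
Proof.
move=> /pdeg_le wy /(@pdeg_vprod a)/pdeg_le dwy; apply/pdeg_le => G nz.
have [|] := pselect (vprod a (bcobd w) G = 0); last by move/eqP; exact: dwy.
rewrite !ffunE => E0; move: nz; rewrite ffunE -[X in X != 0]subr0 -{2}E0.
rewrite mulr_sumr -sumrB => nz.
have [F] : exists F : cell b k, vprod a w F * tcobd R (@clt _) (val F) (val G)
    - a (lead (val G)) * (w F * tcobd R (@clt _) (val F) (val G)) != 0.
  apply/existsP; apply: contraNT nz; rewrite negb_exists => /forallP h.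
  by rewrite big1 // => F _; apply/eqP; have := h F; rewrite negbK.
rewrite ffunE -mulrA -mulrBl => {}nz.
apply: le_trans (wy F _); last first.
  by apply: contra_neq nz => ->; rewrite mul0r mulr0.
apply: cell_pdeg_cobd.
  by apply: contra_neq nz => ->; rewrite !mulr0.
by apply: contra_neq nz => ->; rewrite subrr mul0r.
Qed.

End VertexProduct.

Lemma lead_face n m (b : {ffun 'I_m.+2 -> 'I_n.+1}) l k
    (E : cell (face_blocks b l) k) :
  lead (val (face_cell E)) = lift l (lead (val E)).
Proof.
have /andP[/verticesP[i vE] /forall_inP vmin] := leadP (valP E).
apply: lead_eq; apply/andP; split.
  apply/verticesP; exists i; rewrite ffunE; apply/imsetP.
  by exists (Some (lead (val E))).
apply/forall_inP => w /verticesP[j]; rewrite ffunE => /imsetP[[u|//] uE [->]].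
by rewrite leq_bump2 vmin //; apply/verticesP; exists j.
Qed.

(** * The product with a function on the space *)

Section Vertices.
Variable K : realType.

Fact vertex_subproof m (v : 'I_m.+1) : @std_simplex K m (delta_mx 0 v).
Proof.
split=> [w|]; first by rewrite mxE ler0n.
rewrite (bigD1 v) //= mxE !eqxx big1 ?addr0 // => w /negbTE wv.
by rewrite mxE wv andbF.
Qed.

Definition vertex m (v : 'I_m.+1) : @std_simplex K m :=
  SigSub (mem_set (vertex_subproof v)).

Lemma face_incl_vertex m (l : 'I_m.+2) v :
  face_incl l (vertex v) = vertex (lift l v).
Proof.
apply/val_inj/rowP => w; rewrite !mxE /=; case: unliftP => [u ->|->].
  by rewrite mxE (inj_eq lift_inj).
by rewrite (negbTE (neq_lift _ _)).
Qed.

Section Simplices.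
Variables (R : comPzRingType) (n : nat).

Section FunctionProduct.
Variables (X : perverse_space n) (P : set (set X)) (h : X -> R).

Definition fprod k (w : cochain_family K R P k) : cochain_family K R P k :=
  fun s => vprod (fun v => h (s (vertex v))) (w s).

Lemma fprod_in k (w : cochain_family K R P k) :
  w \in @is_blowup_cochain K R n X P k ->
  fprod w \in @is_blowup_cochain K R n X P k.
Proof.
move=> /asboolP[cw /allowableP aw /allowableP dw]; apply/asboolP; split.
- move=> m b s l t ts; rewrite /fprod -(cw _ _ _ _ _ ts).
  apply/ffunP => E; rewrite !ffunE /= lead_face.
  by rewrite ts /= face_incl_vertex.
- by apply/allowableP => i S s ltin iS sS; apply: pdeg_vprod; exact: aw.
- apply/allowableP => i S s ltin iS sS; apply: pdeg_bcobd_vprod.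
  + exact: (@rs_join _ _ _ _ _ _ s).
  + exact: aw.
  + exact: dw.
Qed.

End FunctionProduct.

(** * Transport along embeddings and gluing *)

Lemma regular_simplex_eq (X : perverse_space n) (P : set (set X)) m
    (b : {ffun 'I_m.+1 -> 'I_n.+1}) (s t : regular_simplex K P b) :
  rs_map s = rs_map t -> s = t.
Proof.
case: s t => [s s1 s2 s3 s4 s5] [t t1 t2 t3 t4 t5] /= st.
rewrite st in s1 s3 s5 *.
by congr RegularSimplex; apply: Prop_irrelevance.
Qed.

Definition embedding (Y X : topologicalType) (g : Y -> X) :=
  injective g /\ forall A, open A -> exists2 B, open B & g @^-1` B = A.

Section Embedding.
Variables (Y X : perverse_space n) (Q : set (set Y)) (P : set (set X)).
Variable g : perverse_map Y X.
Hypothesis g_emb : embedding g.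

Lemma rs_lift m (b : {ffun 'I_m.+1 -> 'I_n.+1}) (s : regular_simplex K P b) :
  range s `<=` range g -> (forall A, g @` A = range s -> Q A) ->
  exists t : regular_simplex K Q b, g \o t = s.
Proof.
move=> sg sQ.
have ex x : exists y, g y = s x by have [y _ <-] := sg _ (imageT s x); exists y.
pose t x := projT1 (cid (ex x)).
have gt : g \o t = s by apply/funext => x; exact: projT2 (cid (ex x)).
have tc : continuous t.
  apply/continuousP => A /g_emb.2[B oB <-]; rewrite -comp_preimage gt.
  by move/continuousP: (@rs_continuous _ _ _ _ _ _ s); apply.
have tf (i : 'I_n.+1) x :
    skel Y i (t x) <-> (forall v, (i < b v)%N -> \val x 0 v = 0).
  by rewrite -(rs_filtered s) -gt (pm_skel g).
have tQ : Q (range t) by apply: sQ; rewrite image_comp gt.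
by exists (RegularSimplex tc (@rs_join _ _ _ _ _ _ s) tf (rs_regular s) tQ).
Qed.

Hypothesis QP : forall A, Q A -> P (g @` A).

(** The extension by [d]: the simplices of [X] that do not lift to [Y] get the
    value of [d].  By injectivity of [g] the choice of the lift does not matter. *)
Definition extend k (w : cochain_family K R Q k) (d : cochain_family K R P k) :
    cochain_family K R P k := fun s =>
  match pselect (exists t : regular_simplex K Q (s_blocks s), g \o t = s) with
  | left e => w (Simplex (projT1 (cid e)))
  | right _ => d s
  end.

Lemma extend_lift k (w : cochain_family K R Q k) d m
    (b : {ffun 'I_m.+1 -> 'I_n.+1}) (s : regular_simplex K P b)
    (t : regular_simplex K Q b) :
  g \o t = s -> extend w d (Simplex s) = w (Simplex t).
Proof.
move=> ts; rewrite /extend; case: pselect => [e|[]]; last by exists t.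
case: cid => t' /= ts'; congr (w (Simplex _)); apply: regular_simplex_eq.
apply/funext => x; apply: g_emb.1.
by rewrite -[LHS]/((g \o t') x) ts' -ts.
Qed.

Lemma pull_extend k (w : cochain_family K R Q k) d : pull QP (extend w d) = w.
Proof.
apply: functional_extensionality_dep => -[m b t].
exact: extend_lift.
Qed.

Lemma extend_out k (w : cochain_family K R Q k) d m
    (b : {ffun 'I_m.+1 -> 'I_n.+1}) (s : regular_simplex K P b) :
  ~ (exists t : regular_simplex K Q b, g \o t = s) ->
  extend w d (Simplex s) = d (Simplex s).
Proof. by move=> sN; rewrite /extend; case: pselect. Qed.

End Embedding.

(** The conditions on a blow-up cochain are local: a face of a simplex lies in
    every subspace containing the simplex, and a stratum of [X] met by a simplex of
    [Y] contains a stratum of [Y] met by it, with the same perversity. *)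
Lemma blowup_local (X : perverse_space n) (P : set (set X)) k
    (w : cochain_family K R P k) :
  (forall m (b : {ffun 'I_m.+1 -> 'I_n.+1}) (s : regular_simplex K P b),
    exists (Y : perverse_space n) (Q : set (set Y)) (g : perverse_map Y X)
      (QP : forall A, Q A -> P (g @` A)),
    [/\ embedding g, forall A B, A `<=` B -> Q B -> Q A,
        exists t : regular_simplex K Q b, g \o t = s
      & pull QP w \in @is_blowup_cochain K R n Y Q k]) ->
  w \in @is_blowup_cochain K R n X P k.
Proof.
move=> loc.
have pullE (Y : perverse_space n) (Q : set (set Y)) (g : perverse_map Y X)
    (QP : forall A, Q A -> P (g @` A)) j (u : cochain_family K R P j) m
    (b : {ffun 'I_m.+1 -> 'I_n.+1}) (s : regular_simplex K P b)
    (t : regular_simplex K Q b) : g \o t = s ->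
    u (Simplex s) = pull QP u (Simplex t).
  by move=> ts; congr (u (Simplex _)); apply: regular_simplex_eq.
have al j (u : cochain_family K R P j) :
    (forall m (b : {ffun 'I_m.+1 -> 'I_n.+1}) (s : regular_simplex K P b),
    exists (Y : perverse_space n) (Q : set (set Y)) (g : perverse_map Y X)
      (QP : forall A, Q A -> P (g @` A)),
    (exists t : regular_simplex K Q b, g \o t = s) /\ allowable (pull QP u)) ->
    allowable u.
  move=> {}loc; apply/allowableP => i S [m b s] ltin iS [_ [[x _ <-] Sx]].
  have [Y [Q [g [QP [[t ts] /allowableP a]]]]] := loc _ _ s.
  rewrite (pullE _ _ _ QP _ _ _ _ _ _ ts).
  (* The stratum of Y through t x, which S contains and whose perversity it has. *)
  have Sy : S (g (t x)) by rewrite -[g _]/((g \o t) x) ts.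
  have Ly : layer (skel Y) i (t x).
    have := stratum_sub iS Sy; rewrite /layer /setD /=.
    by case: (i) => [|i'] /=; rewrite !(pm_skel g).
  pose S' := connected_component (layer (skel Y) i) (t x).
  have iS' : stratum (skel Y) i S' by exists (t x).
  have S't : S' (t x) by exact: connected_component_refl.
  have [S'' iS'' sub] := stratum_img (@pm_continuous _ _ _ g) (@pm_skel _ _ _ g) iS'.
  have S''x : S'' (g (t x)) by apply: sub; exists (t x).
  have [_ SE] := stratum_eq iS'' iS S''x Sy.
  rewrite SE in sub; rewrite -(pm_perv iS' iS sub).
  by apply: (a i S' (Simplex t)) => //; exists (t x); split=> //; exists x.
apply/asboolP; split.
- move=> m b s l t ts.
  have [Y [Q [g [QP [ge Qsub [s' ss'] /asboolP[c _ _]]]]]] := loc _ _ s.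
  have [] := @rs_lift _ _ Q _ _ ge _ _ t.
  + move=> _ [x _ <-]; rewrite ts -ss' /=; exact: imageT.
  + move=> A At; apply: Qsub (rs_image s') => y Ay.
    have : range t (g y) by rewrite -At; exists y.
    by rewrite ts -ss' => -[x _ /= /ge.1 <-]; exact: imageT.
  move=> t' tt'; rewrite (pullE _ _ _ QP _ _ _ _ _ _ ss').
  rewrite (pullE _ _ _ QP _ _ _ _ _ _ tt').
  apply: c; apply/funext => x; apply: ge.1.
  by rewrite -[LHS]/((g \o t') x) tt' ts -ss'.
- apply: al => m b s.
  have [Y [Q [g [QP [ge Qsub s' /asboolP[_ a _]]]]]] := loc _ _ s.
  by exists Y, Q, g, QP.
- apply: al => m b s.
  have [Y [Q [g [QP [ge Qsub s' /asboolP[_ _ a]]]]]] := loc _ _ s.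
  by exists Y, Q, g, QP.
Qed.


(** * Simplices of subspaces *)

Section Subspaces.
Variables (X : perverse_space n).

Lemma incl_map_embedding (U : set X) : embedding (incl_map U).
Proof. by split; [exact: val_inj | move=> A [B oB <-]; exists B]. Qed.

Lemma incl_sub_embedding (V U : set X) (VU : V `<=` U) :
  embedding (incl_sub VU).
Proof.
split=> [x y /(congr1 \val) xy|A [B oB <-]]; first exact: val_inj.
exists (\val @^-1` B : set (subspace_of U)) => //.
by exists B.
Qed.

Lemma small_sub T (V : set (set T)) A B : A `<=` B -> small V B -> small V A.
Proof. by move=> AB [C VC BC]; exists C => // x /AB/BC. Qed.

Lemma val_lift (P : set (set X)) (U : set X) (V : set (set X)) m
    (b : {ffun 'I_m.+1 -> 'I_n.+1}) (s : regular_simplex K P b) A :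
  V A -> A `<=` U -> range s `<=` A ->
  exists t : regular_simplex K (small (trace_cover (U := U) V)) b,
    incl_map U \o t = s.
Proof.
move=> VA AU sA; apply: rs_lift; first exact: incl_map_embedding.
  by move=> y /sA/AU Uy; exists (SigSub (mem_set Uy)).
move=> B Bs; exists (\val @^-1` A); first by exists A.
by move=> y By; apply: sA; rewrite -Bs; exists y.
Qed.

Lemma sub_lift (U V : set X) (VU : V `<=` U) (P : set (set (subspace_of U))) m
    (b : {ffun 'I_m.+1 -> 'I_n.+1}) (s : regular_simplex K P b) :
  range s `<=` \val @^-1` V ->
  exists t : regular_simplex K [set: set (subspace_of V)] b,
    incl_sub VU \o t = s.
Proof.
move=> sV; apply: rs_lift => //; first exact: incl_sub_embedding.
move=> y /sV Vy; exists (SigSub (mem_set (Vy : V (\val y)))) => //.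
exact: val_inj.
Qed.

(** The vanishing of [w] on the simplices of [V] makes it compatible with zero: a
    simplex that does not lie in [W] may have faces in [W], but then it lies in
    [V], and so do these faces. *)
Lemma extend_by_zero (U W V : set X) (WU : W `<=` U) (VU : V `<=` U)
    (QP : forall A, [set: set (subspace_of W)] A ->
      small (trace_cover (U := U) [set W; V]) (incl_sub WU @` A)) k
    (w : cochain_family K R [set: set (subspace_of W)] k) :
  w \in @is_blowup_cochain K R n _ _ k ->
  (forall s : simplex K [set: set (subspace_of W)],
    range s `<=` \val @^-1` V -> w s = 0) ->
  extend (P := small (trace_cover (U := U) [set W; V])) (incl_sub WU) w 0
    \in @is_blowup_cochain K R n _ _ k.
Proof.
move=> w_in w0; apply: blowup_local => m b s.
have [_ [A VA <-] sA] := rs_image s.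
have [sW|sW] := pselect (range s `<=` \val @^-1` W).
  exists (subspace_of W), setT, (incl_sub WU), QP; split => //.
  - exact: incl_sub_embedding.
  - exact: sub_lift.
  - by rewrite pull_extend //; exact: incl_sub_embedding.
have sV : range s `<=` \val @^-1` V by case: VA sA => ->.
exists (subspace_of V), setT, (incl_sub VU), (incl_sub_small VU (or_intror erefl)).
split => //; [exact: incl_sub_embedding|exact: sub_lift|].
rewrite (_ : pull _ _ = 0).
  by have [] := @is_blowup_cochain_closed K R n _ [set: set (subspace_of V)] k.
apply: functional_extensionality_dep => -[m' b' t]; rewrite /pull.
set t' := push _ _.
have [[r rt]|h] := pselect (exists r : regular_simplex K setT b', incl_sub WU \o r = t').
  rewrite (extend_lift _ _ _ rt); last exact: incl_sub_embedding.
  rewrite [LHS]w0 // => _ [x _ <-] /=.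
  have := congr1 (fun f => \val (f x)) rt => /= ->.
  exact: set_mem (valP (t x)).
by rewrite extend_out.
Qed.

End Subspaces.

(** * The three exactness statements *)

Section ExactSequence.
Variables (X : perverse_space n) (U1 U2 : set X) (f1 f2 : X -> K).
Hypothesis f1_supp : f1 @^-1` `]1 / 2, 1] `<=` U1.
Hypothesis f2_supp : f2 @^-1` `]1 / 2, 1] `<=` U2.

Local Notation W := (U1 `&` U2).
Local Notation P := (small (mv_cover U1 U2 f1 f2)).
Local Notation P1 := (small (trace_cover (U := U1) (mv_cover1 U1 U2 f1))).
Local Notation P2 := (small (trace_cover (U := U2) (mv_cover2 U1 U2 f2))).
Local Notation WU1 := (@subIsetl _ U1 U2).
Local Notation WU2 := (@subIsetr _ U1 U2).
Local Notation WP1 := (@incl_sub_small _ _ W U1 (mv_cover1 U1 U2 f1) WU1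
  (or_introl erefl)).
Local Notation WP2 := (@incl_sub_small _ _ W U2 (mv_cover2 U1 U2 f2) WU2
  (or_introl erefl)).

Lemma small_lift m (b : {ffun 'I_m.+1 -> 'I_n.+1}) (s : regular_simplex K P b) :
  (exists t : regular_simplex K P1 b, incl_map U1 \o t = s) \/
  (exists t : regular_simplex K P2 b, incl_map U2 \o t = s).
Proof.
have [A [VA|VA] sA] := rs_image s; [left|right]; apply: val_lift (VA) _ sA.
  by case: VA => ->.
by case: VA => ->.
Qed.

Lemma mv_iota_inj k : injective (mv_iota R U1 U2 f1 f2 k).
Proof.
move=> w w' E.
have E1 := congr1 (fun u => bc_family u.1) E.
have E2 := congr1 (fun u => bc_family u.2) E.
apply: val_inj; apply: functional_extensionality_dep => -[m b s] /=.
have [[t ts]|[t ts]] := small_lift s.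
  have := congr1 (fun f => f (Simplex t)) E1; rewrite /= /pull.
  by rewrite (_ : push _ t = s) //; exact: regular_simplex_eq.
have := congr1 (fun f => f (Simplex t)) E2; rewrite /= /pull.
by rewrite (_ : push _ t = s) //; exact: regular_simplex_eq.
Qed.

Lemma mv_phi_iota k w : mv_phi R U1 U2 f1 f2 k (mv_iota R U1 U2 f1 f2 k w) = 0.
Proof.
rewrite /= /diff_fun /=; apply/eqP; rewrite subr_eq0; apply/eqP.
apply: val_inj; apply: functional_extensionality_dep => -[m b s] /=.
by rewrite /pull; congr (bc_family w (Simplex _)); exact: regular_simplex_eq.
Qed.

(** The glued cochain takes the value of the first cochain on the simplices of
    [U1] and that of the second one on the others.  A simplex of [U2] that also
    lies in [U1] is a simplex of the intersection, where the two agree, so the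
    second cochain is indeed its restriction to [U2]. *)
Lemma mv_glue k (w1 : blowup_cochain K R P1 k) (w2 : blowup_cochain K R P2 k) :
  mv_phi R U1 U2 f1 f2 k (w1, w2) = 0 ->
  exists w, mv_iota R U1 U2 f1 f2 k w = (w1, w2).
Proof.
move=> E.
have {}E (q : simplex K [set: set (subspace_of W)]) :
    pull WP1 w1 q = pull WP2 w2 q.
  by move: E => /subr0_eq/(congr1 (fun u => bc_family u q)).
have e1 := incl_map_embedding U1; have e2 := incl_map_embedding U2.
pose w := extend (P := P) (incl_map U1) w1 (extend (P := P) (incl_map U2) w2 0).
have QP1 := small_trace (U := U1)
  (@subsetUl _ (mv_cover1 U1 U2 f1) (mv_cover2 U1 U2 f2)).
have QP2 := small_trace (U := U2)
  (@subsetUr _ (mv_cover1 U1 U2 f1) (mv_cover2 U1 U2 f2)).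
have pw1 : pull QP1 w = w1 by exact: pull_extend.
have pw2 : pull QP2 w = w2.
  apply: functional_extensionality_dep => -[m b t]; rewrite /pull /w.
  set s := push _ _.
  have [[r rs]|h] := pselect (exists r : regular_simplex K P1 b, incl_map U1 \o r = s).
    rewrite (extend_lift _ _ _ rs) //.
    have rt x : \val (r x) = \val (t x).
      by rewrite -[LHS]/((incl_map U1 \o r) x) rs.
    have rW : range r `<=` \val @^-1` W.
      move=> _ [x _ <-]; split; first exact: set_mem (valP (r x)).
      by rewrite /= rt; exact: set_mem (valP (t x)).
    have [q qr] := sub_lift WU1 rW.
    have := E (Simplex q); rewrite /pull.
    rewrite [push _ _](_ : _ = r); last exact: regular_simplex_eq.
    move=> ->; congr (bc_family w2 (Simplex _)); apply: regular_simplex_eq.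
    by apply/funext => x; apply: val_inj; rewrite -rt -qr.
  by rewrite extend_out // (extend_lift e2 _ _ (t := t)).
have w_in : w \in @is_blowup_cochain K R n _ _ k.
  apply: blowup_local => m b s; have [st|st] := small_lift s.
    exists (subspace_of U1), P1, (incl_map U1), QP1.
    by split => //; [exact: small_sub|rewrite pw1; exact: bc_in].
  exists (subspace_of U2), P2, (incl_map U2), QP2.
  by split => //; [exact: small_sub|rewrite pw2; exact: bc_in].
by exists (BlowupCochain w_in); congr pair; apply: val_inj; [exact: pw1|exact: pw2].
Qed.

Hypothesis f12 : forall x, f1 x + f2 x = 1.

(** With [h] the characteristic function of [f1 <= 1/2], a cochain [w] of the
    intersection is [h w - (-(1 - h) w)], where [h w] vanishes on the simplices
    of [f1 > 1/2] and [(1 - h) w] on those of [f2 > 1/2], which is contained in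
    [f1 < 1/2].  So the two terms extend by zero to [U1] and [U2]. *)
Lemma mv_phi_surj k w : exists w', mv_phi R U1 U2 f1 f2 k w' = w.
Proof.
pose h (x : subspace_of W) : R := (f1 (\val x) <= 1 / 2)%R%:R.
have z1 (s : simplex K [set: set (subspace_of W)]) :
    range s `<=` \val @^-1` (f1 @^-1` `]1 / 2, 1]) -> fprod h w s = 0.
  move=> sV; apply/ffunP => E; rewrite !ffunE.
  have := sV _ (imageT s (vertex (lead (val E)))).
  rewrite /= in_itv /= => /andP[f1x _].
  by rewrite /h leNgt f1x mul0r.
have z2 (s : simplex K [set: set (subspace_of W)]) :
    range s `<=` \val @^-1` (f2 @^-1` `]1 / 2, 1]) ->
    fprod (fun x => 1 - h x) w s = 0.
  move=> sV; apply/ffunP => E; rewrite !ffunE.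
  have := sV _ (imageT s (vertex (lead (val E)))).
  rewrite /= in_itv /= => /andP[f2x _].
  have := f12 (\val (s (vertex (lead (val E))))).
  rewrite /h; set x := \val _ in f2x * => fx.
  by rewrite (_ : (f1 x <= 1 / 2) = true) ?subrr ?mul0r //; lra.
have u1_in := extend_by_zero f1_supp WP1 (fprod_in h (bc_in w)) z1.
have u2_in := extend_by_zero f2_supp WP2 (fprod_in _ (bc_in w)) z2.
exists (BlowupCochain u1_in, - BlowupCochain u2_in).
rewrite /= /diff_fun linearN opprK /=; apply: val_inj.
apply: functional_extensionality_dep => s /=.
have p1 := pull_extend (incl_sub_embedding WU1) WP1 (fprod h w) 0.
have p2 := pull_extend (incl_sub_embedding WU2) WP2 (fprod (fun x => 1 - h x) w) 0.
transitivity (fprod h w s + fprod (fun x => 1 - h x) w s).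
  by rewrite -[in RHS]p1 -[in RHS]p2.
by apply/ffunP => E; rewrite !ffunE -mulrDl subrKC mul1r.
Qed.

End ExactSequence.

End Simplices.
End Vertices.

Theorem theorem3 (K : realType) (R : comPzRingType) (n : nat)
  (X : perverse_space n) (X_proper : prev_skel (skel X) n `<` skel X n)
  (X_paracompact : paracompact X)
  (U1 U2 : set X) (U1_open : open U1) (U2_open : open U2)
  (U_cover : U1 `|` U2 = [set: X])
  (f1 f2 : X -> K) (f_partition : subordinate_partition U1 U2 f1 f2) :
  short_exact (mv_iota R U1 U2 f1 f2) (mv_phi R U1 U2 f1 f2).
Proof.
case: f_partition => _ _ f12 supp1 supp2.
have half0 (x : K) : x \in `]1 / 2, 1] -> x != 0.
  rewrite in_itv /= => /andP[x0 _]; rewrite gt_eqF //.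
  by apply: le_lt_trans x0; rewrite divr_ge0.
have VU1 : f1 @^-1` `]1 / 2, 1] `<=` U1.
  by move=> x /half0 fx; apply/supp1/subset_closure.
have VU2 : f2 @^-1` `]1 / 2, 1] `<=` U2.
  by move=> x /half0 fx; apply/supp2/subset_closure.
move=> k; split; first exact: mv_iota_inj.
- apply/seteqP; split=> [_ [w _ <-]|[w1 w2] /mv_glue E]; first exact: mv_phi_iota.
  by have [w ww] := E VU1 VU2; exists w.
- by apply/seteqP; split=> // w _; have [w' <-] := mv_phi_surj VU1 VU2 f12 w; exists w'.
Qed.
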